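(* Suppose that the discrete matrix $\mathbf{M}_\kappa$ is invertible, let $\epsilon>0$ be a given tolerance, and suppose the adaptive multi-grade deep learning algorithm terminates at grade (iteration) $l^*$ such that $$\|\tilde e_{l^*}^*\|_N\le\frac{\epsilon}{2\|\mathbf{M}_\kappa^{-1}\|_2}.$$ If the quadrature error bound satisfies $\mathcal{E}(\gamma,\beta,\kappa,m)\le\|\tilde e_{l^*}^*\|_N$, then the resulting approximate solution $\tilde y_{l^*}^*$ satisfies $$\|y-\tilde y_{l^*}^*\|_N\le\epsilon .$$
   Context: Let $I:=[-1,1]$, and let $C(I)$ be the space of continuous complex-valued functions on $I$. Let $\kappa\ge1$, let $K$ be a continuous complex-valued function on $I^2$ (smooth in its second variable), and $f\in C(I)$. Define $(\mathcal{K}h)(s):=\int_I K(s,t)e^{i\kappa|s-t|}h(t)\,dt$ for $h\in C(I)$, $s\in I$; $\mathcal{I}$ is the identity on $C(I)$. The function $y\in C(I)$ is the solution of $(\mathcal{I}-\mathcal{K})y=f$. Discretization. Let $\Gamma\ge0$, $\beta\ge1$, $\gamma\ge\Gamma+3$, $q\in\mathbb{N}$ (positive), $p_\kappa:=\lceil\gamma\kappa^\beta\rceil$, $h:=2/p_\kappa$, $s_j:=-1+jh$ ($j=0,\dots,p_\kappa$). The composite trapezoidal operator is, for $F\in C(I)$, $s\in I$, $$(\mathcal{K}_{p_\kappa}F)(s):=\frac h2\Big[F(s_0)K(s,s_0)e^{i\kappa|s-s_0|}+2\sum_{j=1}^{p_\kappa-1}K(s,s_j)F(s_j)e^{i\kappa|s-s_j|}+K(s,s_{p_\kappa})F(s_{p_\kappa})e^{i\kappa|s-s_{p_\kappa}|}\Big].$$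 Let $N=N_\kappa:=p_\kappa q+1$, $x_j:=-1+\frac{2(j-1)}{N_\kappa-1}$ for $j=1,\dots,N_\kappa$, and $\|g\|_N:=\sqrt{\frac1N\sum_{j=1}^N|g(x_j)|^2}$. Let $\mathbf{M}_\kappa:=\mathbf{I}_\kappa-\frac{1}{p_\kappa}\mathbf{B}_\kappa\in\mathbb{C}^{N_\kappa\times N_\kappa}$, where $\mathbf{I}_\kappa$ is the identity matrix and $\mathbf{B}_\kappa=(b_{j,l})$ has entries $b_{j,l}=K(x_j,x_l)\omega_\kappa^{|j-l|}$ if $l=1$ or $l=N_\kappa$; $b_{j,l}=2K(x_j,x_l)\omega_\kappa^{|j-l|}$ if $l=dq+1$ with $d\in\{1,\dots,p_\kappa-1\}$; $b_{j,l}=0$ otherwise; $\omega_\kappa:=e^{2\kappa i/(qp_\kappa)}$. (So $[((\mathcal{I}-\mathcal{K}_{p_\kappa})h)(x_j)]_j=\mathbf{M}_\kappa[h(x_j)]_j$ for $h\in C(I)$.) For matrices $\|\cdot\|_2$ is the spectral norm. Quadrature error bound. Let $m$ be a positive integer. The solution has the form $y(s)=u_1(s)+u_2(s)e^{i\kappa s}+u_3(s)e^{-i\kappa s}$ with $|u_j^{(r)}(s)|\le\tau$ for all $s\in I$, $r=0,\dots,m$, $j=1,2,3$, for some $\tau>0$; and $\tilde\tau>0$ is a constant with $|(K(t,\cdot)u_j)^{(r)}(s)|\le\tilde\tau$ for all $s,t\in I$, $r=0,\dots,m$, $j=1,2,3$. Set $$\mathcal{E}(\gamma,\beta,\kappa,m):=\frac{132\,\tilde\tau}{5\gamma\kappa^\beta}+\frac{81\,\tilde\tau(\Gamma+3)^m}{5\gamma^m\kappa^{m(\beta-1)}}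 .$$ As part of the setting, the estimate $\|(\mathcal{K}_{p_\kappa}-\mathcal{K})y\|_N\le\mathcal{E}(\gamma,\beta,\kappa,m)$ (known from earlier work) is taken as given. Networks and algorithm. For $u=[u_1,u_2]^T$ with $u_1,u_2$ real-valued on $I$, $\mathcal{T}u:=u_1+iu_2$. Let $\sigma:\mathbb{R}\to\mathbb{R}$ be a continuous activation function applied componentwise. Grade networks have one hidden layer: $\mathcal{N}_2(\{\mathbf{W}_j,\mathbf{b}_j\}_{j=1}^2;x):=\mathbf{W}_2\sigma(\mathbf{W}_1x+\mathbf{b}_1)+\mathbf{b}_2$, with output dimension $2$ and, at grade $l$, input dimension equal to $1$ if $l=1$ and to the hidden width of grade $l-1$ if $l\ge2$. Put $\tilde{\mathbf{g}}_0(s):=s$, $\tilde e_0^*:=f$. At grade $l$ one computes $\{\tilde{\mathbf{W}}_{l,j}^*,\tilde{\mathbf{b}}_{l,j}^*\}_{j=1}^2$ as a minimizer (assumed to exist), over real weights and biases $\theta$ of the prescribed sizes, of $\|\tilde e_l(\theta;\cdot)\|_N^2$, where $\tilde e_l(\theta;s):=\tilde e_{l-1}^*(s)-[(\mathcal{I}-\mathcal{K}_{p_\kappa})\mathcal{T}\mathcal{N}_2(\theta;\tilde{\mathbf{g}}_{l-1}(\cdot))](s)$, and sets $\tilde{\mathbf{g}}_l(s):=\sigma(\tilde{\mathbf{W}}_{l,1}^*\tilde{\mathbf{g}}_{l-1}(s)+\tilde{\mathbf{b}}_{l,1}^* )$, $\tilde{\mathbf{f}}_l:=\tilde{\mathbf{W}}_{l,2}^*\tilde{\mathbf{g}}_l+\tilde{\mathbf{b}}_{l,2}^*$,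 $\tilde e_l^*:=\tilde e_l(\{\tilde{\mathbf{W}}_{l,j}^*,\tilde{\mathbf{b}}_{l,j}^*\}_{j=1}^2;\cdot)$. The adaptive algorithm, given $\epsilon>0$ and a maximal number of grades $L$, starts with grade $l=1$ and, while $l<L$ and $\|\tilde e_l^*\|_N>\epsilon/(2\|\mathbf{M}_\kappa^{-1}\|_2)$, replaces $l$ by $l+1$ and computes grade $l$; upon termination at $l=l^*$ it returns $\tilde y_{l^*}^*:=\sum_{j=1}^{l^*}\mathcal{T}\tilde{\mathbf{f}}_j$. *)

(* Defs.v *)
(* Complex numbers are R[i] over a realType R.
   A function on I = [-1, 1] is a total function on R of which only the values
   on I are used. *)
From HB Require Import structures.
From mathcomp Require Import all_boot all_order all_algebra.
From mathcomp Require Import all_classical all_reals all_analysis.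
From mathcomp Require Import complex spectral.

Set Implicit Arguments.
Unset Strict Implicit.
Unset Printing Implicit Defensive.

Import Order.TTheory GRing.Theory Num.Theory.
Import numFieldNormedType.Exports.

Local Open Scope classical_set_scope.
Local Open Scope complex_scope.
Local Open Scope ring_scope.
Local Open Scope sesquilinear_scope.

(* The modulus as an element of R; the norm `|z| of the library lies in R[i]. *)
Notation cmod := ComplexField.Normc.normc.

Section ComplexFunctions.
Variable R : realType.
Implicit Types (g : R -> R[i]) (s t tau : R) (r m : nat).

Definition Iset : set R := [set` `[-1, 1]].

(* R[i]^o carries the topology given by the modulus. *)
Definition continuous_I g := {within Iset, continuous (g : R -> R[i]^o)}.

Definition continuous_II (K : R -> R -> R[i]) :=
  {within Iset `*` Iset, continuous (fun st : R * R => K st.1 st.2 : R[i]^o)}.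

(* exp (i x) *)
Definition expi (x : R) : R[i] := cos x +i* sin x.

Definition cintegral_I g : R[i] :=
  \int[lebesgue_measure]_(t in Iset) complex.Re (g t)
    +i* \int[lebesgue_measure]_(t in Iset) complex.Im (g t).

(* Derivatives on I: at an end point of I the limit is one-sided. *)
Definition diff_quot_I g s t : R[i]^o := (g t - g s) / (t - s)%:C.

Definition derivable_I g s := cvg (diff_quot_I g s t @[t --> within Iset s^']).

Definition derive_I g s : R[i] := lim (diff_quot_I g s t @[t --> within Iset s^']).

Definition derive_In r g : R -> R[i] := iter r derive_I g.

Definition nderivable_I m g :=
  forall r, (r < m)%N -> forall s, Iset s -> derivable_I (derive_In r g) s.

Definition smooth_I g := forall m, nderivable_I m g.

Definition derivs_bounded_I m tau g :=
  nderivable_I m g /\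
  forall r, (r <= m)%N -> forall s, Iset s -> cmod (derive_In r g s) <= tau.

End ComplexFunctions.

(* The largest singular value of A. *)
Definition spectral_norm (R : realType) (n : nat) (A : 'M[R[i]]_n) : R :=
  sup [set Num.sqrt (complex.Re a) | a in [set a | eigenvalue (A^t* *m A) a]].

Section Operators.
Variables (R : realType) (K : R -> R -> R[i]) (kappa : R).
Implicit Types (g F : R -> R[i]) (s : R) (p q : nat).

Definition int_op g s : R[i] :=
  cintegral_I (fun t => K s t * expi (kappa * `|s - t|) * g t).

Definition trap_node p (j : nat) : R := -1 + j%:R * (2 / p%:R).

Definition trap_op p F s : R[i] :=
  let term j := K s (trap_node p j) * F (trap_node p j)
                * expi (kappa * `|s - trap_node p j|) in
  (2 / p%:R / 2)%:C *
  (term 0%N + 2 * (\sum_(1 <= j < p) term j) + term p).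

(* Collocation nodes, numbered from 0: the N = p * q + 1 nodes are
   node p q j for j = 0, ..., p * q. *)
Definition node p q (j : nat) : R := -1 + 2 * j%:R / (p * q)%:R.

Definition dnorm p q g : R :=
  Num.sqrt ((p * q).+1%:R^-1 *
            \sum_(j < (p * q).+1) cmod (g (node p q j)) ^+ 2).

Definition omega p q : R[i] := expi (2 * kappa / (q * p)%:R).

(* Rows and columns are numbered from 0: column d * q is column d * q + 1 of
   the usual numbering. *)
Definition matB p q : 'M[R[i]]_((p * q).+1) :=
  \matrix_(j, l)
    let v := K (node p q j) (node p q l) * omega p q ^+ `|j%:Z - l%:Z|%N in
    if (l == ord0) || (l == ord_max) then v
    else if [exists d : 'I_p, (0 < d)%N && (l == d * q :> nat)%N] then 2 * v
    else 0.

Definition matM p q : 'M[R[i]]_((p * q).+1) := 1%:M - p%:R^-1 *: matB p q.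

End Operators.

Definition quad_error (R : realType) (Gamma ttau gamma beta kappa : R)
    (m : nat) : R :=
  132 * ttau / (5 * gamma * kappa `^ beta) +
  81 * ttau * (Gamma + 3) ^+ m / (5 * gamma ^+ m * kappa `^ (m%:R * (beta - 1))).

(* Weights and biases of a network with input dimension n, one hidden layer of
   width w and output dimension 2. *)
Record params (R : Type) (n w : nat) := Params {
  W1 : 'M[R]_(w, n);
  b1 : 'cV[R]_w;
  W2 : 'M[R]_(2, w);
  b2 : 'cV[R]_2 }.

Section Network.
Variables (R : realType) (sigma : R -> R) (n w : nat).
Implicit Types (theta : params R n w) (x : 'cV[R]_n).

Definition hidden theta x : 'cV[R]_w :=
  map_mx sigma (W1 theta *m x + b1 theta).

Definition network theta x : 'cV[R]_2 :=
  W2 theta *m hidden theta x + b2 theta.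

Definition toC (u : 'cV[R]_2) : R[i] := u 0 0 +i* u 1 0.

End Network.

(* width l is the hidden width of grade l >= 1; feature_dim width l is the
   dimension of the l-th feature map, the input dimension of grade l + 1. *)
Definition feature_dim (width : nat -> nat) (l : nat) : nat :=
  if l is 0 then 1%N else width l.

Section MultiGrade.
Variables (R : realType) (K : R -> R -> R[i]) (kappa : R) (f : R -> R[i]).
Variables (p q : nat) (sigma : R -> R) (width : nat -> nat).

(* theta l holds the parameters of grade l + 1. *)
Variable theta :
  forall l, params R (feature_dim width l) (feature_dim width l.+1).

Fixpoint feature (l : nat) : R -> 'cV[R]_(feature_dim width l) :=
  if l is l'.+1 then fun s => hidden sigma (theta l') (feature l' s)
  else fun s => const_mx s.

(* The component computed at grade l + 1. *)
Definition component (l : nat) (s : R) : 'cV[R]_2 :=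
  W2 (theta l) *m feature l.+1 s + b2 (theta l).

(* The error function of a grade with parameters th, where e and g are the
   optimal error and the feature map of the preceding grade. *)
Definition grade_error (n w : nat) (e : R -> R[i]) (g : R -> 'cV[R]_n)
    (th : params R n w) (s : R) : R[i] :=
  let v := fun t => toC (network sigma th (g t)) in
  e s - (v s - trap_op K kappa p v s).

Fixpoint opt_error (l : nat) : R -> R[i] :=
  if l is l'.+1 then grade_error (opt_error l') (feature l') (theta l')
  else f.

(* The parameters of grade l + 1 are optimal. *)
Definition grade_optimal (l : nat) :=
  forall th : params R (feature_dim width l) (feature_dim width l.+1),
    dnorm p q (grade_error (opt_error l) (feature l) (theta l)) ^+ 2 <=
    dnorm p q (grade_error (opt_error l) (feature l) th) ^+ 2.

Definition continue_at (L : nat) (tol : R) (l : nat) :=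
  (l < L)%N /\ tol < dnorm p q (opt_error l).

Inductive grade_computed (L : nat) (tol : R) : nat -> Prop :=
| GradeFirst : grade_optimal 0 -> grade_computed L tol 1
| GradeNext l : grade_computed L tol l -> continue_at L tol l ->
    grade_optimal l -> grade_computed L tol l.+1.

Definition terminates_at (L : nat) (tol : R) (l : nat) :=
  grade_computed L tol l /\ ~ continue_at L tol l.

Definition approx_solution (l : nat) (s : R) : R[i] :=
  \sum_(j < l) toC (component j s).

End MultiGrade.

(* Main.v *)
Require Import Defs.
From HB Require Import structures.
From mathcomp Require Import all_boot all_order all_algebra.
From mathcomp Require Import all_classical all_reals all_analysis.
From mathcomp Require Import complex spectral ring lra.

Set Implicit Arguments.
Unset Strict Implicit.
Unset Printing Implicit Defensive.

Import Order.TTheory GRing.Theory Num.Theory.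
Import numFieldNormedType.Exports.

Local Open Scope classical_set_scope.
Local Open Scope ring_scope.

(** The residual [v - trap_op v] of the error [v = y - approx_solution] can be
    bounded by quantities known when the algorithm stops, and inverting the
    collocation matrix turns a small residual into a small error.

    Since the trapezoidal operator is linear, the error functions of the grades
    telescope: the optimal error of the last grade is
    [f - (approx - trap_op approx)] ([opt_errorE]).  Substituting
    [f = y - int_op y], the residual of [v] on the interval is
    [e - (trap_op y - int_op y)], where [e] is the optimal error.  The quadrature
    error is at most the given bound, hence at most [dnorm e], so the residual has
    discrete norm at most [2 * dnorm e], which is at most
    [eps / spectral_norm (invmx matM)].

    The quadrature nodes are among the collocation nodes, so [matM] maps the
    vector of node values of [v] to that of its residual ([matM_node_values]).
    Therefore [dnorm v] is at most [spectral_norm (invmx matM)] times the norm of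
    the residual ([dnorm_le_inv]), that is, at most [eps].  This last step needs
    the operator-norm property of the largest singular value ([sqnorm_mul_le]),
    which follows by diagonalizing [A^* A] in an orthonormal basis. *)

(** * The spectral norm as an operator norm *)

Section SqNorm.
Local Open Scope complex_scope.
Local Open Scope sesquilinear_scope.
Variable R : realType.

Lemma normc_sqrC (z : R[i]) : (cmod z ^+ 2)%:C = z^*%C * z.
Proof. by rewrite mulrC -sqr_normc rmorphXn. Qed.

(** The defect of this inequality is the squared modulus of [z + w], by the
    parallelogram law. *)
Lemma normc_sqrB_le (z w : R[i]) :
  cmod (z - w) ^+ 2 <= 2 * (cmod z ^+ 2 + cmod w ^+ 2).
Proof.
case: z w => a b [c d] /=.
rewrite !sqr_sqrtr ?addr_ge0 ?sqr_ge0 //.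
rewrite -subr_ge0.
suff -> : 2 * (a ^+ 2 + b ^+ 2 + (c ^+ 2 + d ^+ 2)) -
   ((a - c) ^+ 2 + (b - d) ^+ 2) = (a + c) ^+ 2 + (b + d) ^+ 2.
  by rewrite addr_ge0 ?sqr_ge0.
by ring.
Qed.

Definition sqnorm n (v : 'cV[R[i]]_n) : R := \sum_j cmod (v j 0) ^+ 2.

Lemma sqnorm_ge0 n (v : 'cV[R[i]]_n) : 0 <= sqnorm v.
Proof. by apply: sumr_ge0 => j _; rewrite sqr_ge0. Qed.

Lemma sqnormE n (v : 'cV[R[i]]_n) : (sqnorm v)%:C = (v^t* *m v) 0 0.
Proof.
rewrite mxE rmorph_sum; apply: eq_bigr => j _ /=.
by rewrite normc_sqrC !mxE.
Qed.

Lemma sqnorm_unitary n (P : 'M[R[i]]_n) (v : 'cV[R[i]]_n) :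
  P \is unitarymx -> sqnorm (P *m v) = sqnorm v.
Proof.
move=> uP; apply/complexI; rewrite !sqnormE trmx_mul map_mxM.
by rewrite !mulmxA mulmxKtV.
Qed.

(** The eigenvalues are among the finitely many roots of the characteristic
    polynomial, so the sum over these roots is a bound. *)
Lemma spectral_norm_has_ubound n (A : 'M[R[i]]_n) :
  has_ubound [set Num.sqrt (complex.Re a) |
                   a in [set a | eigenvalue (A^t* *m A) a]].
Proof.
have [rs rsE] := closed_field_poly_normal (char_poly (A^t* *m A)).
exists (\sum_(z <- rs) Num.sqrt (complex.Re z)) => _ [a /= ea <-].
have a_rs : a \in rs.
  move: ea; rewrite eigenvalue_root_char rsE rootZ ?root_prod_XsubC //.
  by rewrite lead_coef_eq0 monic_neq0 ?char_poly_monic.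
by rewrite (big_rem a) //= lerDl sumr_ge0 // => z _; exact: sqrtr_ge0.
Qed.

Lemma spectral_norm_ge0 n (A : 'M[R[i]]_n) : 0 <= spectral_norm A.
Proof.
rewrite /spectral_norm; set E := [set _ | _ in _].
have [E0|/set0P[_ [a Ea _]]] := eqVneq E set0; first by rewrite E0 sup0.
apply: le_trans (sqrtr_ge0 (complex.Re a)) _.
by apply: (ub_le_sup (@spectral_norm_has_ubound _ A)); exists a.
Qed.

(** In an orthonormal basis of eigenvectors of [A^* A] the squared norm of [A v]
    is a combination of the squared coordinates of [v] whose weights are the
    eigenvalues.  Each eigenvalue is the squared norm of the image under [A] of its
    eigenvector, hence real and nonnegative, which makes it the square of one of
    the numbers whose supremum is the spectral norm. *)
Lemma sqnorm_mul_le n (A : 'M[R[i]]_n) (v : 'cV[R[i]]_n) :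
  sqnorm (A *m v) <= spectral_norm A ^+ 2 * sqnorm v.
Proof.
pose H := A^t* *m A.
have /orthomx_spectralP H_eq : H \is normalmx.
  by apply/normalmxP; rewrite /H trmx_mul map_mxM trmxCK.
set P := spectralmx H in H_eq; set d := spectral_diag H in H_eq.
have uP : P \is unitarymx by exact: spectral_unitarymx.
have PP : P *m P^t* = 1%:M by exact/unitarymxP.
rewrite invmx_unitary // in H_eq.
pose c i := sqnorm (col i (A *m P^t*)).
have dE i : d 0 i = (c i)%:C.
  have /(congr1 (fun X => fun_of_matrix X i i)) :
      diag_mx d = (A *m P^t*)^t* *m (A *m P^t*).
    rewrite trmx_mul map_mxM trmxCK !mulmxA -(mulmxA P) -/H H_eq.
    by rewrite !mulmxA PP mul1mx -mulmxA PP mulmx1.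
  rewrite mxE eqxx mulr1n => ->; rewrite sqnormE !mxE.
  by apply: eq_bigr => j _; rewrite !mxE.
have c_le i : c i <= spectral_norm A ^+ 2.
  (* [eigenvalue] refers to row eigenvectors, here the rows of [P]. *)
  have ev : eigenvalue H (c i)%:C.
    apply/eigenvalueP; exists (row i P).
      rewrite H_eq !mulmxA -row_mul PP row1 -rowE row_diag_mx dE.
      by rewrite -scalemxAl -rowE.
    apply/eqP => /(congr1 (fun x => x *m P^t*)).
    rewrite mul0mx -row_mul PP => /rowP /(_ i) /eqP.
    by rewrite !mxE eqxx oner_eq0.
  have : Num.sqrt (c i) <= spectral_norm A.
    apply: (ub_le_sup (@spectral_norm_has_ubound _ A)).
    by exists (c i)%:C.
  move=> le_s; rewrite -[c i]sqr_sqrtr ?sqnorm_ge0 //.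
  by rewrite lerXn2r ?nnegrE ?sqrtr_ge0 // (le_trans _ le_s) ?sqrtr_ge0.
pose w := P *m v.
have -> : sqnorm (A *m v) = \sum_i c i * cmod (w i 0) ^+ 2.
  apply/complexI; rewrite sqnormE trmx_mul map_mxM mulmxA -(mulmxA _ _ A).
  rewrite -/H H_eq !mulmxA -(mulmxA _ P) -/w.
  have -> : v^t* *m P^t* = w^t* by rewrite /w trmx_mul map_mxM.
  rewrite mul_mx_diag mxE rmorph_sum; apply: eq_bigr => j _ /=.
  by rewrite rmorphM /= normc_sqrC !mxE dE mulrCA mulrA.
rewrite -(sqnorm_unitary v uP) mulr_sumr; apply: ler_sum => i _.
by rewrite ler_wpM2r ?sqr_ge0.
Qed.

End SqNorm.

(** * The collocation matrix *)

Lemma big_nat_dvdn (V : nmodType) (F : nat -> V) (p q : nat) : (0 < q)%N ->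
  \sum_(0 <= l < p * q | (q %| l)%N) F l = \sum_(0 <= d < p) F (d * q)%N.
Proof.
move=> q_gt0; elim: p => [|p IHp]; first by rewrite mul0n !big_nil.
rewrite big_nat_recr //= -IHp (big_cat_nat (n := (p * q)%N)) ?leq_mul //=.
congr (_ + _); rewrite big_ltn_cond ?ltn_mul2r ?q_gt0 ?ltnSn // dvdn_mull //.
rewrite big_nat_cond big_pred0 ?addr0 // => l.
apply/negP => /andP[/andP[l_gt l_lt] /dvdnP[d ld]].
by move: l_gt l_lt; rewrite ld !ltn_mul2r q_gt0 /= ltnS ltnNge => /negbTE ->.
Qed.

Section Collocation.
Local Open Scope complex_scope.
Variables (R : realType) (K : R -> R -> R[i]) (kappa : R) (p q : nat).
Hypotheses (p_gt0 : (0 < p)%N) (q_gt0 : (0 < q)%N).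
Implicit Types F G : R -> R[i].

Lemma expiD (x y : R) : expi (x + y) = expi x * expi y.
Proof. by rewrite /expi cosD sinD; simpc; rewrite [X in _ +i* X]addrC. Qed.

Lemma expiX (x : R) n : expi x ^+ n = expi (x *+ n).
Proof.
elim: n => [|n IHn]; first by rewrite /expi mulr0n cos0 sin0.
by rewrite exprS IHn mulrS expiD.
Qed.

Lemma trap_op_B F G (s : R) :
  trap_op K kappa p (fun t => F t - G t) s =
  trap_op K kappa p F s - trap_op K kappa p G s.
Proof.
rewrite /trap_op.
under eq_bigr do rewrite mulrBr mulrBl.
by rewrite sumrB; ring.
Qed.

(** Each grade subtracts the image under [I - trap_op] of its own component, and
    by linearity these images add up to that of the sum of the components. *)
Lemma opt_errorE (f : R -> R[i]) (sigma : R -> R) (width : nat -> nat)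
  (theta : forall l, params R (feature_dim width l) (feature_dim width l.+1))
  (l : nat) (s : R) :
  opt_error K kappa f p sigma theta l s =
  f s - (approx_solution sigma theta l s
         - trap_op K kappa p (approx_solution sigma theta l) s).
Proof.
elim: l s => [|l IHl] s.
  (* Additivity gives [trap_op 0 = 0] from [0 = 0 - 0]. *)
  have -> : approx_solution sigma theta 0 = (fun=> 0 - 0).
    by apply/funext => t; rewrite /approx_solution big_ord0 subr0.
  by rewrite trap_op_B !subrr subr0.
pose v t := toC (component sigma theta l t).
have -> : opt_error K kappa f p sigma theta l.+1 s =
    opt_error K kappa f p sigma theta l s - (v s - trap_op K kappa p v s) by [].
rewrite IHl.
have vE : v = fun t => approx_solution sigma theta l.+1 t
                       - approx_solution sigma theta l t.
  by apply/funext => t; rewrite /approx_solution big_ord_recr /= addrAC subrr add0r.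
have -> : v s = approx_solution sigma theta l.+1 s
                - approx_solution sigma theta l s by rewrite vE.
by rewrite vE trap_op_B; ring.
Qed.

Lemma trap_nodeE (d : nat) : trap_node R p d = node R p q (d * q).
Proof.
rewrite /trap_node /node !natrM; congr (_ + _); field.
by rewrite !pnatr_eq0 -!lt0n p_gt0 q_gt0.
Qed.

Lemma node_in_Iset (j : nat) : (j <= p * q)%N -> Iset (node R p q j).
Proof.
move=> le_j; have pq_gt0 : (0 < (p * q)%:R :> R) by rewrite ltr0n muln_gt0 p_gt0.
rewrite /Iset /= in_itv /= /node lerDl divr_ge0 ?mulr_ge0 ?ler0n //=.
rewrite addrC lerBlDr ler_pdivrMr // -[1 + 1]/(2%:R) ler_pM2l //.
by rewrite ler_nat.
Qed.

Lemma omegaX (j l : nat) :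
  omega kappa p q ^+ `|j%:Z - l%:Z|%N =
  expi (kappa * `|node R p q j - node R p q l|).
Proof.
have pq_gt0 : (0 < (p * q)%:R :> R) by rewrite ltr0n muln_gt0 p_gt0.
rewrite /omega expiX; congr expi.
have -> : node R p q j - node R p q l = 2 / (p * q)%:R * (j%:Z - l%:Z)%:~R.
  rewrite /node rmorphB /= -!pmulrn.
  move: (p * q)%N pq_gt0 => N N_gt0; field.
  by rewrite lt0r_neq0.
rewrite normrM ger0_norm ?divr_ge0 ?ler0n //.
rewrite -intr_norm -abszE -[_ *+ _]mulr_natr -pmulrn (mulnC q).
by move: (p * q)%N => N; ring.
Qed.

Definition node_values g : 'cV[R[i]]_((p * q).+1) :=
  \col_j g (node R p q j).

(** The quadrature nodes are the collocation nodes whose index is a multiple of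
    [q]: the columns of the matrix at these indices carry the trapezoidal weights,
    1 at both ends and 2 inside, and all other columns vanish. *)
Lemma matM_node_values F :
  matM K kappa p q *m node_values F =
  node_values (fun s => F s - trap_op K kappa p F s).
Proof.
apply/colP => j; rewrite /matM mulmxBl mul1mx -scalemxAl.
have -> (X Y : 'cV[R[i]]_((p * q).+1)) : (X - Y) j 0 = X j 0 - Y j 0.
  by rewrite !mxE.
rewrite [RHS]mxE; congr (_ - _); first by rewrite mxE.
rewrite mxE.
pose term l : R[i] := K (node R p q j) (node R p q l) * F (node R p q l) *
   expi (kappa * `|node R p q j - node R p q l|).
have -> : trap_op K kappa p F (node R p q j) = p%:R^-1 *
   (term 0%N + 2 * (\sum_(1 <= d < p) term (d * q)%N) + term (p * q)%N).
  rewrite /trap_op !trap_nodeE mul0n; congr (_ * _).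
    rewrite mulrAC divff ?mul1r ?pnatr_eq0 //.
    by rewrite fmorphV rmorph_nat.
  congr (_ + 2 * _ + _).
  by apply: eq_bigr => d _; rewrite trap_nodeE.
congr (_ * _).
pose coef l : R[i] := if (l == 0)%N || (l == p * q)%N then 1
    else if (q %| l)%N then 2 else 0.
have -> : (matB K kappa p q *m node_values F) j 0 =
    \sum_(0 <= l < (p * q).+1) coef l * term l.
  rewrite mxE big_mkord; apply: eq_bigr => l _; rewrite !mxE omegaX.
  rewrite /coef -!val_eqE /=.
  case: ifP => [_|/negbT]; first by rewrite mul1r /term mulrAC.
  rewrite negb_or => /andP[l0 lpq].
  have -> : [exists d : 'I_p, (0 < d)%N && (l == d * q :> nat)%N] = (q %| l)%N.
    apply/existsP/dvdnP => [[d /andP[_ /eqP ->]]|[d ld]]; first by exists d.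
    have d_lt : (d < p)%N.
      have := ltn_ord l; rewrite ltnS leq_eqVlt (negbTE lpq) /= ld.
      by rewrite ltn_mul2r => /andP[].
    exists (Ordinal d_lt) => /=; rewrite ld eqxx andbT lt0n.
    by apply: contraNneq l0 => d0; rewrite ld d0.
  case: ifP => _; last by rewrite !mul0r.
  by rewrite /term -!mulrA [F _ * _]mulrC.
have pq_gt0 : (0 < p * q)%N by rewrite muln_gt0 p_gt0.
rewrite big_nat_recr //= big_ltn // {1 3}/coef !eqxx orbT !mul1r.
congr (_ + _ + _).
rewrite mulr_sumr.
have -> : \sum_(1 <= l < p * q) coef l * term l =
    \sum_(1 <= l < p * q | (q %| l)%N) 2 * term l.
  rewrite [RHS]big_mkcond /=; apply: eq_big_nat => l /andP[l1 lpq].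
  rewrite /coef (gtn_eqF l1) (ltn_eqF lpq) /=.
  by case: ifP; rewrite ?mul0r.
have := big_nat_dvdn (fun l => 2 * term l) p q_gt0.
rewrite big_ltn_cond // dvdn0 [in RHS]big_ltn // mul0n.
exact: addrI.
Qed.
End Collocation.

(** * The discrete norm *)

Section Dnorm.
Variables (R : realType) (p q : nat).
Implicit Types F G : R -> R[i].

Lemma dnorm_sqr F :
  dnorm p q F ^+ 2 = (p * q).+1%:R^-1 * sqnorm (node_values p q F).
Proof.
rewrite /dnorm sqr_sqrtr.
  by congr (_ * _); apply: eq_bigr => j _; rewrite mxE.
by rewrite mulr_ge0 ?invr_ge0 ?ler0n // sumr_ge0 // => j _; rewrite sqr_ge0.
Qed.

Lemma dnorm_ge0 F : 0 <= dnorm p q F.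
Proof. exact: sqrtr_ge0. Qed.

Lemma eq_dnorm F G :
  (forall s, Iset s -> F s = G s) -> (0 < p)%N -> (0 < q)%N ->
  dnorm p q F = dnorm p q G.
Proof.
move=> FG p0 q0; congr (Num.sqrt (_ * _)); apply: eq_bigr => j _.
by rewrite FG //; apply: node_in_Iset => //; rewrite -ltnS.
Qed.

(** With a common bound [d] the pointwise inequality for squares is sharp enough,
    because [2 * (d ^+ 2 + d ^+ 2) = (2 * d) ^+ 2]; the Cauchy-Schwarz inequality
    of the general triangle inequality is avoided. *)
Lemma dnormB_le F G (d : R) : dnorm p q F <= d -> dnorm p q G <= d ->
  dnorm p q (fun s => F s - G s) <= 2 * d.
Proof.
move=> Fd Gd; have d_ge0 := le_trans (dnorm_ge0 F) Fd.
rewrite -(@ler_pXn2r _ 2) ?nnegrE ?dnorm_ge0 ?mulr_ge0 //.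
have {}Fd : dnorm p q F ^+ 2 <= d ^+ 2 by rewrite ler_pXn2r ?nnegrE ?dnorm_ge0.
have {}Gd : dnorm p q G ^+ 2 <= d ^+ 2 by rewrite ler_pXn2r ?nnegrE ?dnorm_ge0.
have : dnorm p q (fun s => F s - G s) ^+ 2 <=
    2 * (dnorm p q F ^+ 2 + dnorm p q G ^+ 2).
  rewrite !dnorm_sqr -mulrDr mulrCA ler_wpM2l ?invr_ge0 ?ler0n //.
  rewrite /sqnorm -big_split mulr_sumr; apply: ler_sum => j _ /=.
  by rewrite !mxE normc_sqrB_le.
move/le_trans; apply; lra.
Qed.

(** The discrete norm is the Euclidean norm of the node values up to a factor
    common to both sides, so the operator norm of [invmx matM] for the Euclidean
    norm bounds the amplification of the residual. *)
Lemma dnorm_le_inv (K : R -> R -> R[i]) (kappa : R) F :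
  (0 < p)%N -> (0 < q)%N -> matM K kappa p q \in unitmx ->
  dnorm p q F <= spectral_norm (invmx (matM K kappa p q)) *
    dnorm p q (fun s => F s - trap_op K kappa p F s).
Proof.
move=> p0 q0 uM; set M := matM K kappa p q in uM *.
set G := (X in _ * dnorm p q X).
have FE : node_values p q F = invmx M *m node_values p q G.
  by rewrite -matM_node_values // mulKmx.
rewrite -(@ler_pXn2r _ 2) ?nnegrE ?dnorm_ge0 ?mulr_ge0
  ?spectral_norm_ge0 ?dnorm_ge0 //.
rewrite exprMn !dnorm_sqr FE mulrCA ler_wpM2l ?invr_ge0 ?ler0n //.
exact: sqnorm_mul_le.
Qed.
End Dnorm.

(** * The error of the approximate solution *)

Theorem theorem5 (R : realType)
  (* the integral equation *)
  (kappa : R) (kappa_ge1 : 1 <= kappa)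
  (K : R -> R -> R[i]) (K_cont : continuous_II K)
  (K_smooth : forall s, Iset s -> smooth_I (K s))
  (f : R -> R[i]) (f_cont : continuous_I f)
  (y : R -> R[i]) (y_cont : continuous_I y)
  (y_sol : forall s, Iset s -> y s - int_op K kappa y s = f s)
  (* the discretization *)
  (Gamma beta gamma : R) (Gamma_ge0 : 0 <= Gamma) (beta_ge1 : 1 <= beta)
  (gamma_ge : Gamma + 3 <= gamma)
  (q : nat) (q_gt0 : (0 < q)%N)
  (p : nat) (p_def : p%:Z = Num.ceil (gamma * kappa `^ beta))
  (* the structure of the solution and the quadrature error estimate *)
  (m : nat) (m_gt0 : (0 < m)%N)
  (u : 'I_3 -> R -> R[i])
  (y_form : forall s, Iset s ->
     y s = u 0 s + u 1 s * expi (kappa * s) + u 2 s * expi (- (kappa * s)))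
  (tau : R) (tau_gt0 : 0 < tau)
  (u_bound : forall j, derivs_bounded_I m tau (u j))
  (ttau : R) (ttau_gt0 : 0 < ttau)
  (Ku_bound : forall t, Iset t -> forall j,
     derivs_bounded_I m ttau (fun s => K t s * u j s))
  (quadrature : dnorm p q (fun s => trap_op K kappa p y s - int_op K kappa y s)
     <= quad_error Gamma ttau gamma beta kappa m)
  (* the networks and the algorithm *)
  (sigma : R -> R) (sigma_cont : continuous sigma)
  (width : nat -> nat)
  (theta : forall l, params R (feature_dim width l) (feature_dim width l.+1))
  (M_unit : matM K kappa p q \in unitmx)
  (eps : R) (eps_gt0 : 0 < eps) (L lstar : nat)
  (terminates : terminates_at K kappa f p q sigma theta L
     (eps / (2 * spectral_norm (invmx (matM K kappa p q)))) lstar)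
  (tolerance : dnorm p q (opt_error K kappa f p sigma theta lstar)
     <= eps / (2 * spectral_norm (invmx (matM K kappa p q))))
  (error_bound : quad_error Gamma ttau gamma beta kappa m
     <= dnorm p q (opt_error K kappa f p sigma theta lstar)) :
  dnorm p q (fun s => y s - approx_solution sigma theta lstar s) <= eps.
Proof.
have p_gt0 : (0 < p)%N.
  have gk_gt0 : 0 < gamma * kappa `^ beta.
    by apply: mulr_gt0; [lra | apply: powR_gt0; lra].
  by rewrite -ltz_nat p_def ceil_gt0.
set a := approx_solution sigma theta lstar.
set S := spectral_norm _ in tolerance.
set e := opt_error K kappa f p sigma theta lstar in tolerance error_bound.
pose v s := y s - a s.
pose r s := trap_op K kappa p y s - int_op K kappa y s.
have v_res : dnorm p q (fun s => v s - trap_op K kappa p v s) =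
    dnorm p q (fun s => e s - r s).
  apply: eq_dnorm => // s Is; rewrite /v trap_op_B /r /e opt_errorE -y_sol // -/a.
  by ring.
have res_le : dnorm p q (fun s => e s - r s) <= 2 * dnorm p q e.
  by apply: dnormB_le => //; apply: le_trans error_bound.
apply: (le_trans (dnorm_le_inv _ p_gt0 q_gt0 M_unit)).
have S_ge0 : 0 <= S by exact: spectral_norm_ge0.
rewrite v_res -/S.
apply: (@le_trans _ _ (S * (2 * (eps / (2 * S))))).
  by rewrite ler_wpM2l // (le_trans res_le) // ler_wpM2l.
(* For [S = 0] the quotient in the tolerance is 0, since [0^-1 = 0]. *)
have [->|S0] := eqVneq S 0; first by rewrite mul0r ltW.
by rewrite le_eqVlt; apply/orP; left; apply/eqP; field.
Qed.
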